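(* Let $X$ be a smooth complete toric variety with fan $\Sigma$ and Cox ring $R=\mathbb{C}[x_1,\dots,x_r]$. Let $I=(m_1,\dots,m_t)\subset R$ be a monomial ideal with $m_i=x^{k^i}:=x_1^{k^i_1}\cdots x_r^{k^i_r}$, $k^i=(k^i_1,\dots,k^i_r)\in\mathbb{Z}^r_{\ge 0}$, for $1\le i\le t$. Let $\{(\mathcal{C}^\sigma_I,\Delta^\sigma_I)\}_{\sigma\in\Sigma}$ be the Klyachko diagram of $I$. Then for any cone $\sigma\in\Sigma$ and any $m\in M$, $$I^\sigma_m\cong\begin{cases}\mathbf{I}, & m\in \mathcal{C}^\sigma_I\setminus\Delta^\sigma_I,\\ 0,&\text{otherwise.}\end{cases}$$ In particular, $$\bigcup_{i=1}^t \mathcal{C}^\sigma_{k^i}=\mathcal{C}^\sigma_I\setminus\Delta^\sigma_I\quad\text{and}\quad \mathcal{C}^\sigma_0\setminus\bigcup_{i=1}^t\mathcal{C}^\sigma_{k^i}=\Delta^\sigma_I\cup(\mathcal{C}^\sigma_0\setminus\mathcal{C}^\sigma_I).$$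
   Context: Setting. $X$ is an $n$-dimensional smooth complete toric variety over $\mathbb{C}$ with fan $\Sigma\subset N\otimes\mathbb{R}$, $N\cong\mathbb{Z}^n$, $M=\mathrm{Hom}(N,\mathbb{Z})$ the character lattice. $\Sigma(1)=\{\rho_1,\dots,\rho_r\}$ is the ordered set of rays, $\sigma(1)$ the set of rays of a cone $\sigma$, $n(\rho)\in N$ is the first nonzero lattice point on $\rho$, and $\langle m,\rho\rangle:=\langle m,n(\rho)\rangle$. The Cox ring $R=\mathbb{C}[x_1,\dots,x_r]$ has one variable $x_i=x_{\rho_i}$ per ray, with $\deg x_i=[D_{\rho_i}]\in \mathrm{Cl}(X)$; there is the exact sequence $0\to M\xrightarrow{\phi}\mathbb{Z}^r\to\mathrm{Cl}(X)\to0$, $\phi(m)=(\langle m,\rho_1\rangle,\dots,\langle m,\rho_r\rangle)$. For $\sigma\in\Sigma$ put $x^{\hat\sigma}=\prod_{\rho_i\notin\sigma(1)}x_i$. Klyachko filtrations. For a monomial ideal $I$ (which is $\mathbb{Z}^r$-graded), $\sigma\in\Sigma$ and $m\in M$, $I^\sigma_m:=(I_{x^{\hat\sigma}})_{\phi(m)}$, the $\mathbb{Z}^r$-degree $\phi(m)$ part of the localization of $I$ at $x^{\hat\sigma}$. For a monomial ideal, each $I^{\{0\}}_m$ is the one-dimensional space $\mathbb{C}\, x_1^{\langle m,\rho_1\rangle}\cdots x_r^{\langle m,\rho_r\rangle}$, all of which are identified with a fixed one-dimensional space $\mathbf{I}\cong\mathbb{C}$, and $I^\sigma_m$ is identified with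 a subspace of $\mathbf{I}$. Notation. For $k\in\mathbb{Z}^r$ and $\sigma\in\Sigma$, $\mathcal{C}^\sigma_k:=\{m\in M\mid\langle m,\rho_i\rangle\ge k_i\text{ for all }\rho_i\in\sigma(1)\}$, and $\mathcal{C}^\sigma_0:=\mathcal{C}^\sigma_{(0,\dots,0)}$. Klyachko diagram. Let $I=(m_1,\dots,m_t)$, $t\ge1$, be generated by the monomials $m_i$; $\deg_{\rho_j}$ of a monomial is its exponent in $x_j$. Put $s_j=s_{\rho_j}:=\min_i\deg_{\rho_j}(m_i)$. For $\sigma=\mathrm{cone}(\rho_{i_1},\dots,\rho_{i_c})$ of dimension $c$, put $\mathcal{C}^\sigma_I:=\{m\in M\mid\langle m,\rho_{i_p}\rangle\ge s_{i_p},\ 1\le p\le c\}$. For a subset $\mathcal{S}=\{n_1,\dots,n_s\}\subset\{m_1,\dots,m_t\}$ define $\Delta^\sigma_I(\mathcal{S})\subset\mathcal{C}^\sigma_I$ recursively: - $\Delta^\sigma_I(\emptyset):=\mathcal{C}^\sigma_I$. - If $s\ge1$ and $c=0$ (i.e. $\sigma=\{0\}$): $\Delta^\sigma_I(\mathcal{S}):=\emptyset$. - If $s\ge1$ and $c\geq 1$, order the elements so that $\deg_{\rho_{i_c}}(n_{1})\le\cdots\le\deg_{\rho_{i_c}}(n_{s})$. If $c=1$: $\Delta^\sigma_I(\mathcal{S}):=\{m\mid s_{i_1}\le\langle m,\rho_{i_1}\rangle<\deg_{\rho_{i_1}}(n_1)\}$. If $c\ge2$, put $\sigma'=\mathrm{cone}(\rho_{i_1},\dots,\rho_{i_{c-1}})$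 and $\Delta^\sigma_I(\mathcal{S}):=\bigcup_{j=0}^s\Delta^\sigma_I(\mathcal{S})_j$, where $\Delta^\sigma_I(\mathcal{S})_0:=\{m\mid s_{i_c}\le\langle m,\rho_{i_c}\rangle<\deg_{\rho_{i_c}}(n_1)\}\cap\Delta^{\sigma'}_I(\emptyset)$, $\Delta^\sigma_I(\mathcal{S})_j:=\{m\mid\deg_{\rho_{i_c}}(n_j)\le\langle m,\rho_{i_c}\rangle<\deg_{\rho_{i_c}}(n_{j+1})\}\cap\Delta^{\sigma'}_I(\{n_1,\dots,n_j\})$ for $1\le j\le s-1$, $\Delta^\sigma_I(\mathcal{S})_s:=\{m\mid\deg_{\rho_{i_c}}(n_s)\le\langle m,\rho_{i_c}\rangle\}\cap\Delta^{\sigma'}_I(\{n_1,\dots,n_s\})$. Finally $\Delta^\sigma_I:=\Delta^\sigma_I(\{m_1,\dots,m_t\})$. The collection $\{(\mathcal{C}^\sigma_I,\Delta^\sigma_I)\}_{\sigma\in\Sigma}$ is the Klyachko diagram of $I$. *)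

(* Defs.v *)
From HB Require Import structures.
From mathcomp Require Import all_boot all_order all_algebra.
From mathcomp Require Import boolp classical_sets functions cardinality reals.
From mathcomp Require Import mpoly.

Set Implicit Arguments.
Unset Strict Implicit.
Unset Printing Implicit Defensive.

Import Order.TTheory GRing.Theory Num.Theory.

Local Open Scope classical_set_scope.
Local Open Scope ring_scope.

(* The lattice is N = Z^n, realised as 'rV[int]_n inside N_R = 'rV[R]_n; the  *)
(* character lattice M = Hom(N, Z) consists of the additive maps N -> Z, so   *)
(* that <m, u> is the application m u.                                        *)

Notation charLattice n := {additive 'rV[int]_n -> int}.

Section Fans.
Variables (R : realType) (n : nat).
Implicit Types (sigma tau : set 'rV[R]_n) (Sigma : set (set 'rV[R]_n)).

Definition latt (u : 'rV[int]_n) : 'rV[R]_n := map_mx intr u.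

Definition cone_gen (s : nat) (g : 'I_s -> 'rV[int]_n) : set 'rV[R]_n :=
  [set x | exists a : 'I_s -> R,
     (forall i, 0 <= a i) /\ x = \sum_(i < s) a i *: latt (g i)].

Definition rational_polyhedral sigma :=
  exists (s : nat) (g : 'I_s -> 'rV[int]_n), sigma = cone_gen g.

Definition strongly_convex sigma :=
  forall x, sigma x -> sigma (- x) -> x = 0.

(* The linear form u is given by its coordinates in the dual space M_R. *)
Definition face tau sigma :=
  exists u : 'cV[R]_n,
    (forall x, sigma x -> 0 <= (x *m u) 0 0) /\
    tau = sigma `&` [set x | (x *m u) 0 0 = 0].

Definition is_fan Sigma :=
  [/\ finite_set Sigma,
      forall sigma, Sigma sigma ->
        rational_polyhedral sigma /\ strongly_convex sigma,
      forall sigma tau, Sigma sigma -> face tau sigma -> Sigma tau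
    & forall sigma tau, Sigma sigma -> Sigma tau ->
        face (sigma `&` tau) sigma /\ face (sigma `&` tau) tau].

Definition part_of_basis (s : nat) (g : 'I_s -> 'rV[int]_n) :=
  exists (B : 'M[int]_n) (f : 'I_s -> 'I_n),
    [/\ B \in unitmx, injective f & forall i, g i = row (f i) B].

Definition smooth_fan Sigma :=
  forall sigma, Sigma sigma ->
    exists (s : nat) (g : 'I_s -> 'rV[int]_n),
      part_of_basis g /\ sigma = cone_gen g.

Definition complete_fan Sigma := \bigcup_(sigma in Sigma) sigma = setT.

(* The linear span of sigma has dimension d. *)
Definition cone_dim sigma (d : nat) :=
  exists A : 'M[R]_(d, n),
    [/\ row_free A, forall i, sigma (row i A)
      & forall x, sigma x -> (x <= A)%MS].

Section Rays.
Variable r : nat.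

Definition ray_listing Sigma (rho : 'I_r -> set 'rV[R]_n) :=
  injective rho /\ range rho = Sigma `&` [set tau | cone_dim tau 1].

Definition first_lattice_point (ray : set 'rV[R]_n) (u : 'rV[int]_n) :=
  [/\ u != 0, ray (latt u)
    & forall w : 'rV[int]_n, w != 0 -> ray (latt w) ->
        exists a : R, 1 <= a /\ latt w = a *: latt u].

(* sigma(1), as a set of indices of rays *)
Definition cone_rays (rho : 'I_r -> set 'rV[R]_n) sigma : pred 'I_r :=
  [pred i | `[< face (rho i) sigma >]].

End Rays.
End Fans.

(* All localizations of the Cox ring at monomials, and of its ideals, are     *)
(* taken inside its field of fractions, seen as a vector space over C.        *)

Definition coxFrac (C : fieldType) (r : nat) := {fraction {mpoly C[r]}}.

Section CoxFracLmodule.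
Variables (C : fieldType) (r : nat).

HB.instance Definition _ := GRing.Field.on (coxFrac C r).

Definition coxFrac_scale (a : C) (h : coxFrac C r) : coxFrac C r :=
  tofrac (a%:MP : {mpoly C[r]}) * h.

Fact coxFrac_scaleA a b h :
  coxFrac_scale a (coxFrac_scale b h) = coxFrac_scale (a * b) h.
Proof. by rewrite /coxFrac_scale mulrA -rmorphM -mpolyCM. Qed.

Fact coxFrac_scale1 : left_id 1 coxFrac_scale.
Proof. by move=> h; rewrite /coxFrac_scale rmorph1 mul1r. Qed.

Fact coxFrac_scaleDr : right_distributive coxFrac_scale +%R.
Proof. by move=> a g h; rewrite /coxFrac_scale mulrDr. Qed.

Fact coxFrac_scaleDl h : {morph coxFrac_scale^~ h : a b / a + b}.
Proof. by move=> a b; rewrite /coxFrac_scale mpolyCD rmorphD mulrDl. Qed.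

HB.instance Definition _ := GRing.Zmodule_isLmodule.Build C (coxFrac C r)
  coxFrac_scaleA coxFrac_scale1 coxFrac_scaleDr coxFrac_scaleDl.

End CoxFracLmodule.

Section KlyachkoFiltration.
Variables (C : fieldType) (n r : nat) (v : 'I_r -> 'rV[int]_n).
Implicit Types (m : charLattice n) (h : coxFrac C r).

Local Notation toL := (@tofrac {mpoly C[r]} : _ -> coxFrac C r).

Definition phi m : 'I_r -> int := fun i => m (v i).

Definition monomial_ideal (t : nat) (k : 'I_t -> 'X_{1..r}) :
    set {mpoly C[r]} :=
  [set p | exists a : 'I_t -> {mpoly C[r]}, p = \sum_(i < t) a i * 'X_[k i]].

Definition localization (I : set {mpoly C[r]}) (f : {mpoly C[r]}) :
    set (coxFrac C r) :=
  [set h | exists (g : {mpoly C[r]}) (q : nat), I g /\ h = toL g / toL f ^+ q].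

(* The Z^r-graded piece of degree a of the Laurent polynomial ring, which     *)
(* contains every localization at a monomial as a graded subring: fractions   *)
(* g / x^d with g homogeneous of multidegree b and b - d = a.                 *)
Definition degree_part (a : 'I_r -> int) : set (coxFrac C r) :=
  [set h | exists (g : {mpoly C[r]}) (b d : 'X_{1..r}),
     [/\ {subset msupp g <= [:: b]},
         forall i, a i = (b i)%:Z - (d i)%:Z
       & h = toL g / toL 'X_[d]]].

Definition xhat (A : pred 'I_r) : {mpoly C[r]} := \prod_(i | ~~ A i) 'X_i.

Definition filtration (A : pred 'I_r) (I : set {mpoly C[r]}) m :
    set (coxFrac C r) :=
  localization I (xhat A) `&` degree_part (phi m).

(* The fixed one-dimensional space, called II below, is C itself; for each m  *)
(* it is identified with the line spanned by x_1^<m,rho_1> ... x_r^<m,rho_r>. *)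
Definition laurent_monomial m : coxFrac C r :=
  \prod_(i < r) toL 'X_i ^ phi m i.

Definition identification m (c : C^o) : coxFrac C r :=
  (c : C) *: laurent_monomial m.

Fact identification_linear m : linear (identification m).
Proof. by move=> a b c; rewrite /identification scalerDl -scalerA. Qed.

HB.instance Definition _ m := GRing.isLinear.Build C C^o (coxFrac C r) *:%R
  (identification m) (identification_linear m).

(* The linear map identification m restricts to an isomorphism from the       *)
(* subspace W of II onto V.                                                   *)
Definition identified_with m (V : set (coxFrac C r)) (W : set C^o) :=
  set_inj W (identification m) /\ identification m @` W = V.

End KlyachkoFiltration.

Section KlyachkoDiagram.
Variables (n r : nat) (v : 'I_r -> 'rV[int]_n).
Implicit Types (S : seq 'X_{1..r}).

(* C^sigma_k, where A = sigma(1) *)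
Definition ccone (A : {pred 'I_r}) (k : 'I_r -> int) : set (charLattice n) :=
  [set m | forall i, i \in A -> k i <= m (v i)].

Variables (t : nat) (k : 'I_t.+1 -> 'X_{1..r}).

Definition min_deg (j : 'I_r) : nat := \big[minn/k ord0 j]_(i < t.+1) k i j.

Definition cI (l : seq 'I_r) : set (charLattice n) :=
  ccone (mem l) (fun j => (min_deg j)%:Z).

(* The listing of the rays is given in reverse order, as i_c, ..., i_1, since *)
(* the recursion removes the last ray.  The finite set of monomials S is      *)
(* given as a sequence; after sorting, n_j is [nth 0%MM ns j.-1].             *)
Fixpoint delta_rev (l : seq 'I_r) S : set (charLattice n) :=
  if S is [::] then cI l else
  if l is i :: l' then
    let ns := sort (fun a b : 'X_{1..r} => (a i <= b i)%N) S in
    let s := size ns in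
    let d (j : nat) : int := (nth 0%MM ns j.-1 i)%:Z in
    let below := [set m : charLattice n | (min_deg i)%:Z <= m (v i) < d 1%N] in
    if l' is [::] then below else
      (below `&` delta_rev l' [::])
      `|` \bigcup_(j in [set j : nat | (1 <= j <= s.-1)%N])
            ([set m : charLattice n | d j <= m (v i) < d j.+1]
             `&` delta_rev l' (take j ns))
      `|` ([set m : charLattice n | d s <= m (v i)] `&` delta_rev l' ns)
  else set0.

Definition delta (l : seq 'I_r) : set (charLattice n) :=
  delta_rev (rev l) (undup (codom k)).

End KlyachkoDiagram.

(* Main.v *)
Require Import Defs.
From HB Require Import structures.
From mathcomp Require Import all_boot all_order all_algebra.
From mathcomp Require Import complex.
From mathcomp Require Import boolp classical_sets functions cardinality reals.
From mathcomp Require Import mpoly.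
From mathcomp Require Import zify.

Set Implicit Arguments.
Unset Strict Implicit.
Unset Printing Implicit Defensive.

Import Order.TTheory GRing.Theory Num.Theory.

Local Open Scope classical_set_scope.
Local Open Scope ring_scope.

(** Both sides of the proposition are pinned down by one
    combinatorial condition on m: some generator x^(k_i) satisfies
    k_i(j) <= <m, rho_j> for every ray rho_j of sigma.

    On the algebraic side, the piece of degree phi(m) of the Laurent polynomial
    ring is the line spanned by the Laurent monomial x^phi(m)
    ([degree_part_line]), so a filtration piece is either 0 or that whole line.
    The variables outside sigma(1) are inverted in the localization, hence
    x^phi(m) lies in the localized ideal exactly when one of the generators
    divides it in the variables of sigma(1): one direction clears denominators
    with a large power of x^sigmahat ([laurent_localization]), the other reads
    off the divisibility from the support of an element of the ideal
    ([localization_ccone]).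

    On the combinatorial side, Delta(S) turns out to be the set of the m in
    C_I that are not in the cone C_k of any monomial x^k of S
    ([delta_revP]).  Along the last ray i, the sorted i-th exponents of S cut
    the values of <m, rho_i> into slabs, and in each slab the monomials
    n_(j+1), ..., n_s already fail the inequality at i, while
    n_1, ..., n_j meet it and must therefore fail at one of the remaining rays;
    this is the recursion.  For S the set of all generators the complement of
    Delta in C_I is thus the union of the cones of the generators
    ([bigcup_cconeE]), and the last identity is set algebra, since
    Delta is contained in C_I and C_I in C_0. *)

(** * The Klyachko diagram *)

Section Diagram.
Variables (n r : nat) (v : 'I_r -> 'rV[int]_n).
Variables (t : nat) (k : 'I_t.+1 -> 'X_{1..r}).
Implicit Types (m : charLattice n) (l : seq 'I_r) (S : seq 'X_{1..r}).

Lemma min_deg_le i j : (min_deg k j <= k i j)%N.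
Proof.
rewrite /min_deg; elim: index_enum (mem_index_enum i) => // a s IHs.
rewrite inE big_cons => /predU1P[<-|/IHs]; first exact: geq_minl.
exact/leq_trans/geq_minr.
Qed.

Lemma cI_cons i l m :
  cI v k (i :: l) m <-> (min_deg k i)%:Z <= m (v i) /\ cI v k l m.
Proof.
split=> [im | [im lm] j]; last by rewrite inE => /predU1P[->|/lm].
split=> [|j jl]; first by apply: im; rewrite inE eqxx.
by apply: im; rewrite inE jl orbT.
Qed.

(** A uniform form of the recursion: [j] monomials of [S] lie below the slab
    containing <m, rho_i>, whose lower bound is [min_deg k i] when [j = 0].
    When [i] is the only ray left it still applies, because [delta_rev] of the
    empty list is everything at the empty set of monomials and empty elsewhere, so
    that only the slab [j = 0] survives.  [nth] being numbered from 0, the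
    upper bound of the slab is [d j]. *)
Lemma delta_rev_cons i l S m : S != [::] ->
  let ns := sort (fun a b : 'X_{1..r} => (a i <= b i)%N) S in
  let d (j : nat) : int := (nth 0%MM ns j i)%:Z in
  delta_rev v k (i :: l) S m <->
  exists j : nat,
    [/\ (j <= size S)%N,
        (if j is j'.+1 then d j' else (min_deg k i)%:Z) <= m (v i),
        (j < size S)%N -> m (v i) < d j
      & delta_rev v k l (take j ns) m].
Proof.
case: S => // n0 S _ ns d.
have sz : size ns = (size S).+1 by rewrite size_sort.
case: l => [|i' l].
  have -> : delta_rev v k [:: i] (n0 :: S) m
            = ((min_deg k i)%:Z <= m (v i) < d 0%N) by [].
  split=> [/andP[lo hi] | [[|j] [js lo hi]]].
  - by exists 0%N; split; rewrite ?take0.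
  - by rewrite lo hi.
  - by case: (ns) sz {hi lo} => //= a s _ [].
have -> : delta_rev v k [:: i, i' & l] (n0 :: S) =
    ([set m : charLattice n | (min_deg k i)%:Z <= m (v i) < d 0%N]
       `&` delta_rev v k (i' :: l) [::])
    `|` \bigcup_(j in [set j : nat | (1 <= j <= (size ns).-1)%N])
          ([set m : charLattice n | d j.-1 <= m (v i) < d j]
           `&` delta_rev v k (i' :: l) (take j ns))
    `|` ([set m : charLattice n | d (size ns).-1 <= m (v i)]
         `&` delta_rev v k (i' :: l) ns) by [].
rewrite sz; split=> [|[[|j] [js lo hi D]]].
- case=> [[[/andP[lo hi] ?]|[[//|j] /= js [/andP[lo hi] ?]]]|[lo ?]].
  + by exists 0%N; rewrite take0; split.
  + by exists j.+1; split=> //; exact: ltnW.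
  + exists (size S).+1; rewrite take_oversize ?sz //; split=> //=.
    by rewrite ltnn.
- by left; left; rewrite take0 in D; split=> //=; rewrite lo hi.
- move: js; rewrite leq_eqVlt /= => /predU1P[[ej]|js].
    by right; rewrite take_oversize ?sz ?ej // in D; split; rewrite //= -ej.
  left; right; exists j.+1; first by rewrite /= -ltnS.
  by split=> //=; rewrite lo hi.
Qed.

(** The meaning of the recursion.  The hypothesis on [S] is what makes the slabs
    with [j >= 1] start above [min_deg k i]. *)
Lemma delta_revP l S m : {subset S <= codom k} ->
  delta_rev v k l S m <->
  cI v k l m /\
  {in S, forall a : 'X_{1..r}, exists2 j, j \in l & m (v j) < (a j)%:Z}.
Proof.
elim: l S => [|i l IHl] S Sk.
  case: S Sk => [|a S] _ /=; first by split=> [|[]] //; split.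
  by split=> // -[_ /(_ a (mem_head _ _))[]].
have [-> /=|S0] := eqVneq S [::]; first by split=> [|[]] //; split.
rewrite delta_rev_cons //; set ns := sort _ S.
have memns : ns =i S by exact: mem_sort.
have sz : size ns = size S by exact: size_sort.
have takeS j : {subset take j ns <= S} by move=> a /mem_take; rewrite memns.
split=> [[j [js lo hi]]|[/cI_cons[im lm] Slt]].
  rewrite IHl; last by move=> a /takeS/Sk.
  case=> lm take_lt; split.
    apply/cI_cons; split=> //; case: j lo js {hi take_lt} => // j lo js.
    apply: le_trans lo; rewrite lez_nat.
    have /Sk/codomP[i0 ->] : nth 0%MM ns j \in S by rewrite -memns mem_nth ?sz.
    exact: min_deg_le.
  (* below the slab the induction hypothesis applies; above it ray i fails *)
  move=> a; rewrite -memns -[X in a \in X](cat_take_drop j) mem_cat.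
  case/orP=> [/take_lt[j' j'l lt]|].
    by exists j'; rewrite // inE j'l orbT.
  move=> /(nthP 0%MM)[p]; rewrite size_drop nth_drop sz => pj <-.
  have js' : (j < size S)%N by lia.
  exists i; first exact: mem_head.
  apply: lt_le_trans (hi js') _; rewrite lez_nat.
  apply: (sorted_leq_nth (leT := fun a b : 'X_{1..r} => (a i <= b i)%N)).
  - by move=> b c e; apply: leq_trans.
  - by move=> b.
  - by apply: sort_sorted => b c; apply: leq_total.
  - by rewrite inE sz.
  - by rewrite inE sz; lia.
  - exact: leq_addr.
(* The slab of m ends at the first monomial failing the inequality at i. *)
pose j := find (fun a : 'X_{1..r} => m (v i) < (a i)%:Z) ns.
have before p : (p < j)%N -> (nth 0%MM ns p i)%:Z <= m (v i).
  by move=> /(before_find 0%MM)/negbT; rewrite -leNgt.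
exists j; split.
- by rewrite -sz find_size.
- by case: (j) before => // p; apply.
- by rewrite -sz -has_find => /(nth_find 0%MM).
apply/IHl; first by move=> a /takeS/Sk.
split=> // a aj; have [j'] := Slt _ (takeS _ _ aj).
rewrite inE => /predU1P[->|]; last by exists j'.
case/(nthP 0%MM): aj => p; rewrite size_take => pj <-.
have {}pj : (p < j)%N by move: pj; case: ifP => //; lia.
by rewrite nth_take // ltNge before.
Qed.

Lemma delta_sub l : delta v k l `<=` cI v k l.
Proof.
move=> m; rewrite /delta delta_revP => [[lm _] j jl|a]; last first.
  by rewrite mem_undup.
by apply: lm; rewrite [_ \in _]mem_rev.
Qed.

Lemma eq_ccone (A B : {pred 'I_r}) (f : 'I_r -> int) :
  A =i B -> ccone v A f = ccone v B f.
Proof.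
by move=> AB; apply/seteqP; split=> m mf j jA; apply: mf; rewrite AB in jA *.
Qed.

Lemma bigcup_cconeE l (A : {pred 'I_r}) : l =i A ->
  \bigcup_i ccone v A (fun j => (k i j)%:Z) = cI v k l `\` delta v k l.
Proof.
move=> lA; under eq_bigcupr do rewrite -(eq_ccone _ lA).
have Sk : {subset undup (codom k) <= codom k} by move=> a; rewrite mem_undup.
apply/seteqP; split=> m.
  case=> i _ im; split.
    by move=> j jl; apply: le_trans (im j jl); rewrite lez_nat min_deg_le.
  rewrite /delta delta_revP // => -[_ /(_ (k i))[]].
    by rewrite mem_undup codom_f.
  by move=> j; rewrite mem_rev => /im; rewrite leNgt => /negbTE->.
case=> lm; apply: contra_notP => nm; rewrite /delta delta_revP //; split.
  by move=> j; rewrite [_ \in _]mem_rev; apply: lm.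
move=> a; rewrite mem_undup => /codomP[i ->]; apply: contrapT => nj.
apply: nm; exists i => // j jl; rewrite leNgt; apply/negP => lt.
by apply: nj; exists j; rewrite ?mem_rev.
Qed.

End Diagram.

(** * The filtration of a monomial ideal *)

Section Filtration.
Variables (C : fieldType) (n r : nat) (v : 'I_r -> 'rV[int]_n).
Implicit Types (m : charLattice n) (h : coxFrac C r) (A : pred 'I_r).

Local Notation toL := (@tofrac {mpoly C[r]} : _ -> coxFrac C r).
Local Notation laurent m := (laurent_monomial C v m).

Lemma monom_neq0 (b : 'X_{1..r}) : toL 'X_[b] != 0.
Proof. by rewrite tofrac_eq0 -msupp_eq0 msuppX. Qed.

Lemma coxFracZE (c : C) h : c *: h = toL c%:MP * h.
Proof. by []. Qed.

Lemma tofracZ (c : C) (g : {mpoly C[r]}) : toL (c *: g) = c *: toL g.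
Proof. by rewrite coxFracZE -mul_mpolyC tofracM. Qed.

Lemma laurentE m (b d : 'X_{1..r}) :
  (forall i, m (v i) = (b i)%:Z - (d i)%:Z) ->
  laurent m = toL 'X_[b] / toL 'X_[d].
Proof.
move=> mE; rewrite !mpolyXE_id !rmorph_prod /= -prodf_div.
apply: eq_bigr => i _; rewrite /phi mE !tofracXn.
have Xi : (toL 'X_i : {fraction {mpoly C[r]}}) != 0 by exact: monom_neq0.
by rewrite expfzDr // exprnN.
Qed.

Lemma laurent_neq0 m : laurent m != 0.
Proof.
rewrite /laurent_monomial prodf_seq_neq0; apply/allP => i _.
by apply/implyP => _; apply: expfz_neq0; exact: monom_neq0.
Qed.

Lemma character_split m :
  exists b d : 'X_{1..r}, forall i, m (v i) = (b i)%:Z - (d i)%:Z.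
Proof.
exists [multinom `|m (v i)|%N | i < r].
exists [multinom `| `|m (v i)|%N%:Z - m (v i)|%N | i < r] => i.
by rewrite !mnmE; lia.
Qed.

(** Every piece of the grading of the Laurent polynomial ring is a line, since a
    polynomial homogeneous of multidegree b is a multiple of x^b. *)
Lemma degree_part_line m h :
  degree_part (phi v m) h <-> exists c : C, h = c *: laurent m.
Proof.
split=> [[g [b [d [gb mE ->]]]]|[c ->]].
  exists g@_b; rewrite (laurentE mE) coxFracZE mulrA -tofracM mul_mpolyC.
  congr (toL _ / _); apply/mpolyP => a; rewrite mcoeffZ mcoeffX.
  have [<-|ab] := eqVneq b a; first by rewrite mulr1.
  rewrite mulr0; apply: memN_msupp_eq0; apply/negP => /gb.
  by rewrite inE eq_sym (negbTE ab).
have [b [d mE]] := character_split m; exists (c *: 'X_[b]), b, d; split=> //.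
  by move=> a /msuppZ_le; rewrite msuppX.
by rewrite (laurentE mE) tofracZ !coxFracZE mulrA.
Qed.

Lemma xhat_exprn A q :
  xhat C A ^+ q = 'X_[[multinom (if A i then 0 else q) | i < r]].
Proof.
rewrite /xhat -prodrXl mpolyXE_id big_mkcond; apply: eq_bigr => i _ /=.
by rewrite mnmE; case: (A i).
Qed.

Variables (t : nat) (k : 'I_t -> 'X_{1..r}).

Lemma msupp_monomial_ideal (g : {mpoly C[r]}) a :
  monomial_ideal k g -> a \in msupp g -> exists i b, a = (k i + b)%MM.
Proof.
case=> p -> /msupp_sum_le/flatten_mapP[i _].
by rewrite (perm_mem (msuppMX _ _)) => /mapP[b _ ->]; exists i, b.
Qed.

(** x^phi(m) = x^(k_i + w) / xhat^q: dividing by x^(k_i) leaves negative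
    exponents only in variables outside [A], which a power of [xhat] absorbs. *)
Lemma laurent_localization A m (c : C) i : ccone v A (fun j => (k i j)%:Z) m ->
  localization (monomial_ideal k) (xhat C A) (c *: laurent m).
Proof.
(* q only has to exceed every k_i(j) - <m, rho_j> *)
move=> im; pose q := (\sum_j `|m (v j) - (k i j)%:Z|)%N.
have le_q j : (`|m (v j) - (k i j)%:Z| <= q)%N.
  by rewrite /q (bigD1 j) //= leq_addr.
pose d := [multinom (if A j then 0%N else q) | j < r].
pose w := [multinom `|(m (v j) - (k i j)%:Z + (d j)%:Z)%R|%N | j < r].
have mE j : m (v j) = ((k i + w)%MM j)%:Z - (d j)%:Z.
  rewrite mnmDE !mnmE; have := le_q j; case: ifPn => [/im|_]; lia.
exists (c *: 'X_[(k i + w)]), q; split.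
  exists (fun j => if j == i then c *: 'X_[w] else 0).
  rewrite (bigD1 i) //= eqxx big1 ?addr0 => [|j /negbTE->]; last first.
    by rewrite mul0r.
  by rewrite -scalerAl -mpolyXD addmC.
by rewrite (laurentE mE) -tofracXn xhat_exprn tofracZ !coxFracZE mulrA.
Qed.

(** If c x^phi(m) = g / xhat^q with g in the ideal, then the monomial
    x^phi(m) xhat^q belongs to the support of g, so some x^(k_i) divides it; and
    xhat^q involves no variable of [A]. *)
Lemma localization_ccone A m (c : C) : c != 0 ->
  localization (monomial_ideal k) (xhat C A) (c *: laurent m) ->
  exists i, ccone v A (fun j => (k i j)%:Z) m.
Proof.
move=> c0 [g [q [gI]]]; have [b [d mE]] := character_split m.
rewrite (laurentE mE) coxFracZE mulrA -tofracM mul_mpolyC -tofracXn xhat_exprn.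
set e := [multinom _ | _ < _] => /eqP; rewrite eqr_div ?monom_neq0 // -!tofracM.
rewrite tofrac_eq -scalerAl -mpolyXD => /eqP gE.
(* With phi(m) = b - d, the equation is g x^d = c x^(b + e). *)
have : (b + e)%MM \in msupp (g * 'X_[d]) by rewrite -gE msuppMCX ?inE.
rewrite (perm_mem (msuppMX _ _)) => /mapP[a].
move=> /(msupp_monomial_ideal gI)[i [w ->]] be.
exists i => j Aj; have /= := congr1 (fun f : 'X_{1..r} => f j) be.
rewrite !mnmDE mnmE mE; have -> : A j by []; lia.
Qed.

Lemma filtration_identified A m :
  identified_with v m (filtration v A (monomial_ideal k) m)
    (if `[< (\bigcup_i ccone v A (fun j => (k i j)%:Z)) m >]
     then setT else [set 0 : C^o]).
Proof.
split.
  move=> a b _ _ /eqP; rewrite /identification -subr_eq0 -scalerBl coxFracZE.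
  rewrite mulf_eq0 (negbTE (laurent_neq0 m)) orbF tofrac_eq0 mpolyC_eq0.
  by rewrite subr_eq0 => /eqP.
apply/seteqP; split=> [_ [c Wc <-]|h [hI /degree_part_line[c hE]]].
  split; last by apply/degree_part_line; exists c.
  move: Wc; case: asboolP => [[i _ im] _|_ ->].
    exact: laurent_localization im.
  exists 0, 0%N; split; last by rewrite /identification scale0r tofrac0 mul0r.
  by exists (fun=> 0); rewrite big1 // => i _; rewrite mul0r.
exists c => //; case: asboolP => // nm /=; apply: contrapT => /eqP c0.
case: (@localization_ccone A m c c0) => [|i im].
  by rewrite -hE.
by apply: nm; exists i.
Qed.

End Filtration.

(** * The proposition *)

Theorem proposition3p4 (R : realType) (n r : nat)
  (Sigma : set (set 'rV[R]_n))
  (fanSigma : is_fan Sigma)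
  (smoothSigma : smooth_fan Sigma)
  (completeSigma : complete_fan Sigma)
  (rho : 'I_r -> set 'rV[R]_n)
  (rhoP : ray_listing Sigma rho)
  (v : 'I_r -> 'rV[int]_n)
  (vP : forall i, first_lattice_point (rho i) (v i))
  (t : nat) (k : 'I_t.+1 -> 'X_{1..r})
  (sigma : set 'rV[R]_n) (sigmaP : Sigma sigma)
  (l : seq 'I_r) (uniq_l : uniq l) (lP : l =i cone_rays rho sigma) :
  [/\ forall m : charLattice n,
        identified_with v m
          (filtration v (cone_rays rho sigma) (@monomial_ideal R[i] r t.+1 k) m)
          (if `[< (cI v k l `\` delta v k l) m >] then setT else [set 0]),
      \bigcup_(i : 'I_t.+1)
        ccone v (cone_rays rho sigma) (fun j => (k i j)%:Z)
      = cI v k l `\` delta v k l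
    & ccone v (cone_rays rho sigma) (fun=> 0)
        `\` \bigcup_(i : 'I_t.+1)
              ccone v (cone_rays rho sigma) (fun j => (k i j)%:Z)
      = delta v k l `|` (ccone v (cone_rays rho sigma) (fun=> 0) `\` cI v k l)].
Proof.
have UE := bigcup_cconeE v k lP.
split=> [m||]; [by rewrite -UE; exact: filtration_identified | exact: UE |].
have sub0 : cI v k l `<=` ccone v (cone_rays rho sigma) (fun=> 0).
  by rewrite -(eq_ccone v _ lP) => m lm j /lm; apply: le_trans.
rewrite UE setDDr setUC; congr (_ `|` _).
by apply/setIidr => m /delta_sub/sub0.
Qed.
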